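(* Let $e\ge0$ and let $S_e=\mathbb{P}(\mathcal{O}_{\mathbb{P}^1}\oplus\mathcal{O}_{\mathbb{P}^1}(-e))$ be a rational ruled surface. Let $A\equiv aX_0+bf$ be a nef divisor on $S_e$. 1. When $e=0$, $\epsilon(A,x)=\min\{A\cdot f,\;A\cdot X_0\}=\min\{a,b\}$ for every $x\in S_e$. 2. When $e>0$: (a) If $x\in X_0$, then $\epsilon(A,x)=\min\{A\cdot f,\;A\cdot X_0\}=\min\{a,b-ae\}$. (b) If $x\notin X_0$, then $\epsilon(A,x)=A\cdot f=a$.
   Context: We work over $\mathbb{C}$; $\equiv$ is numerical equivalence. $X_0$ is a section of the $\mathbb{P}^1$-bundle $S_e\to\mathbb{P}^1$ of minimum self-intersection and $f$ is a fibre, so $X_0^2=-e$, $X_0\cdot f=1$, $f^2=0$. The Seshadri constant of a nef divisor $A$ at $x$ is $\epsilon(A,x)=\inf\{A\cdot C/\mathrm{mult}_x(C)\}$ over irreducible curves $C$ through $x$. *)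

(* Defs.v *)
From HB Require Import structures.
From mathcomp Require Import all_boot all_order all_algebra generic_quotient.
From mathcomp Require Import boolp classical_sets reals.
From mathcomp Require Import complex mpoly.

Set Implicit Arguments.
Unset Strict Implicit.
Unset Printing Implicit Defensive.

Import Order.TTheory GRing.Theory Num.Theory.
Local Open Scope quotient_scope.
Local Open Scope ring_scope.

(* S_e = P(O + O(-e)) -> P^1 is given in Cox coordinates (t0, t1, y0, y1): it is
   the quotient of (C^2 \ 0) x (C^2 \ 0) by the torus (C^* )^2 acting by
     (l, m) . (t0, t1, y0, y1) = (l t0, l t1, m y0, l^e m y1),
   and the bundle map to P^1 is [t0 : t1].  (With P(E) the one-dimensional
   quotients of E, i.e. the lines of E^* = O + O(e), the coordinate y1 is the one
   on O(e).)  The curve y0 = 0 is the section of self-intersection -e. *)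

Definition t0 : 'I_4 := @Ordinal 4 0 isT.
Definition t1 : 'I_4 := @Ordinal 4 1 isT.
Definition y0 : 'I_4 := @Ordinal 4 2 isT.
Definition y1 : 'I_4 := @Ordinal 4 3 isT.

Section RuledSurface.
Variables (R : realType) (e : nat).

Local Notation C := R[i].

Definition cox_point : Type :=
  {p : {ffun 'I_4 -> C} |
     ((p t0 != 0) || (p t1 != 0)) && ((p y0 != 0) || (p y1 != 0))}.
HB.instance Definition _ := Choice.on cox_point.

Definition torus_weight (l m : C) (k : 'I_4) : C :=
  if k == y0 then m else if k == y1 then l ^+ e * m else l.

Definition same_orbit (p q : cox_point) : bool :=
  `[< exists l m : C, [/\ l != 0, m != 0 &
        forall k, val q k = torus_weight l m k * val p k] >].

Lemma same_orbit_refl : reflexive same_orbit.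
Proof.
move=> p; apply/asboolP; exists 1, 1; split; rewrite ?oner_neq0 // => k.
by rewrite /torus_weight expr1n mulr1 !if_same mul1r.
Qed.

Lemma same_orbit_sub p q : same_orbit p q -> same_orbit q p.
Proof.
move=> /asboolP[l [m [l0 m0 h]]]; apply/asboolP; exists l^-1, m^-1.
split; rewrite ?invr_eq0 // => k; rewrite h mulrA -[LHS]mul1r; congr (_ * _).
rewrite /torus_weight; case: ifP => _; first by rewrite mulVf.
case: ifP => _; last by rewrite mulVf.
by rewrite exprVn mulrACA !mulVf ?mulr1 ?expf_neq0.
Qed.

Lemma same_orbit_sym : ssrbool.symmetric same_orbit.
Proof. by move=> p q; apply/idP/idP; apply: same_orbit_sub. Qed.

Lemma same_orbit_trans : transitive same_orbit.
Proof.
move=> q p r /asboolP[l [m [l0 m0 h]]] /asboolP[l' [m' [l0' m0' h']]].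
apply/asboolP; exists (l' * l), (m' * m); split; rewrite ?mulf_neq0 // => k.
rewrite h' h mulrA; congr (_ * _).
by rewrite /torus_weight exprMn; case: ifP => // _; case: ifP => // _; rewrite mulrACA.
Qed.

Canonical same_orbit_equiv :=
  EquivRel same_orbit same_orbit_refl same_orbit_sym same_orbit_trans.

Definition surface : Type := {eq_quot same_orbit_equiv}.
HB.instance Definition _ := Choice.on surface.

Definition coords (x : surface) : 'I_4 -> C := val (repr (x : {eq_quot same_orbit_equiv})).

(* Cox grading: y0 has class (1, 0), y1 has class (1, e), t0 and t1 have class
   (0, 1). *)
Definition bihomogeneous (a b : nat) (F : {mpoly C[4]}) : Prop :=
  forall m : 'X_{1..4}, m \in msupp F ->
    (m y0 + m y1 = a)%N /\ (m t0 + m t1 + e * m y1 = b)%N.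

Definition irreducible_form (F : {mpoly C[4]}) : Prop :=
  [/\ F != 0, F \isn't a GRing.unit &
      forall G H : {mpoly C[4]}, F = G * H ->
        G \is a GRing.unit \/ H \is a GRing.unit].

(* An irreducible curve on S_e is given by its equation in the Cox ring, an
   irreducible bihomogeneous form (unique up to a nonzero constant). *)
Record curve := Curve {
  equation :> {mpoly C[4]};
  curve_bihomogeneous : exists a b : nat, bihomogeneous a b equation;
  curve_irreducible : irreducible_form equation }.

Definition lies_on (x : surface) (D : curve) : Prop := D.@[coords x] = 0.

(* With p = coords x, fix a nonzero coordinate t_i of p and a nonzero coordinate
   y_j of p.  The open set t_i != 0, y_j != 0 of S_e is an affine plane,
   identified with the slice t_i = p_i, y_j = p_j; 'X_0 and 'X_1 are the affine
   coordinates on it (the other t, the other y) translated so that x is the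
   origin. *)
Definition base_chart (x : surface) : 'I_4 := if coords x t0 != 0 then t0 else t1.
Definition fibre_chart (x : surface) : 'I_4 := if coords x y0 != 0 then y0 else y1.

Definition local_coord (x : surface) (k : 'I_4) : {mpoly C[2]} :=
  (coords x k)%:MP +
  (if (k == base_chart x) || (k == fibre_chart x) then 0
   else if (k == t0) || (k == t1) then 'X_0 else 'X_1).

Definition local_equation (D : curve) (x : surface) : {mpoly C[2]} :=
  comp_mpoly [tuple local_coord x k | k < 4] D.

(* Order of vanishing at the origin: the least degree of a monomial of a nonzero
   g (whose monomials all have degree < msize g). *)
Definition order_at_origin (g : {mpoly C[2]}) : nat :=
  \big[minn/msize g]_(m <- msupp g) mdeg m.

Definition mult (x : surface) (D : curve) : nat := order_at_origin (local_equation D x).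

(* The local equations generate the maximal ideal at x: both vanish at x, and
   their linear parts are independent. *)
Definition transversal_at (D E : curve) (x : surface) : Prop :=
  let g := local_equation D x in let h := local_equation E x in
  [/\ lies_on x D, lies_on x E &
      g@_U_(0) * h@_U_(1) - g@_U_(1) * h@_U_(0) != 0].

(* Finite formal sums of irreducible curves. *)
Definition divisor : Type := seq (int * curve).

(* The rational section in the Cox coordinates whose divisor is D. *)
Definition divisor_section (D : divisor) : {fraction {mpoly C[4]}} :=
  \prod_(c <- D) (FracField.tofrac (equation c.2)) ^ c.1.

(* D - D' = div (P / Q), where P / Q is a rational function on S_e. *)
Definition lin_equiv (D D' : divisor) : Prop :=
  exists (a b : nat) (P Q : {mpoly C[4]}),
    [/\ bihomogeneous a b P, bihomogeneous a b Q, P != 0, Q != 0 &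
        divisor_section D =
          divisor_section D' * (FracField.tofrac P / FracField.tofrac Q)].

(* Biadditive extension to divisors of a pairing on irreducible curves. *)
Definition intersect (I : curve -> curve -> int) (D E : divisor) : int :=
  \sum_(c <- D) \sum_(d <- E) c.1 * d.1 * I c.2 d.2.

Definition prime_divisor (D : curve) : divisor := [:: (1, D)].

(* The intersection pairing is the unique symmetric biadditive pairing on
   divisors which is invariant under linear equivalence and which counts the
   common points of two curves meeting transversally (Hartshorne, Algebraic
   Geometry, Theorem V.1.1). *)
Record intersection_pairing (I : curve -> curve -> int) : Prop := {
  pairing_sym : forall D E, I D E = I E D;
  pairing_lin_equiv : forall D D' E,
    lin_equiv D D' -> intersect I D E = intersect I D' E;
  pairing_transversal : forall (D E : curve) (s : seq surface),
    uniq s ->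
    (forall x, x \in s <-> lies_on x D /\ lies_on x E) ->
    (forall x, x \in s -> transversal_at D E x) ->
    I D E = (size s)%:Z }.

Definition num_equiv (I : curve -> curve -> int) (D E : divisor) : Prop :=
  forall G : divisor, intersect I D G = intersect I E G.

Definition nef (I : curve -> curve -> int) (D : divisor) : Prop :=
  forall G : curve, 0 <= intersect I D (prime_divisor G).

(* The fibre over [c0 : c1]. *)
Definition is_fibre (D : curve) : Prop :=
  exists c0 c1 : C, ((c0 != 0) || (c1 != 0)) /\
    equation D = c1 *: 'X_t0 - c0 *: 'X_t1.

(* The image of a section of S_e -> P^1, that is of a morphism
   [t] |-> [t : g(t) : h(t)] where g and h are binary forms without common zero
   in P^1. *)
Definition is_section (D : curve) : Prop :=
  exists g h : {mpoly C[2]},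
    (forall c : 'I_2 -> C, (exists k, c k != 0) -> (g.@[c] != 0) || (h.@[c] != 0)) /\
    equation D = comp_mpoly [tuple 'X_t0; 'X_t1] h * 'X_y0
               - comp_mpoly [tuple 'X_t0; 'X_t1] g * 'X_y1.

Definition minimal_section (I : curve -> curve -> int) (D : curve) : Prop :=
  is_section D /\ forall E, is_section E -> I D D <= I E E.

Definition seshadri (I : curve -> curve -> int) (A : divisor) (x : surface) : R :=
  inf [set (intersect I A (prime_divisor D))%:~R / (mult x D)%:R | D in [set D | lies_on x D]]%classic.

End RuledSurface.

(* Main.v *)
Require Import Defs.
From mathcomp Require Import all_boot all_order all_algebra generic_quotient zify ring.
From mathcomp Require Import boolp classical_sets reals.
From mathcomp Require Import complex mpoly.

(** Everything is read off the Cox ring.  Let T and Y be the curves t0 = 0 and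
    y0 = 0.  A curve whose equation has bidegree (a, b) is linearly equivalent to
    aY + bT, because its equation divided by y0^a t0^b is a rational function, so
    the pairing is determined by three numbers.  T^2 = 0, since T is equivalent to
    the disjoint curve t1 = 0; Y.T = 1, since Y and T meet transversally in one
    point; and Y^2 = -e, since y1 = 0 is equivalent to Y + eT and disjoint from Y
    ([pairingE]).  A section has bidegree (1, b) and self-intersection 2b - e, so
    one of minimal self-intersection has bidegree (1, 0)
    ([minimal_section_class]).  Hence A.D = al (b - ae) + be a for every curve D
    of bidegree (al, be), where nefness says that both a and b - ae are
    nonnegative.

    The geometric input is that a curve D through x other than the fibre
    through x has mult_x D <= D.f = al ([fibre_or_mult_le]).  Restricted to
    the fibre, the equation of D becomes a polynomial of degree at most al in
    one variable.  If it is nonzero, then some monomial of degree at most al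
    occurs in the local equation of D; if it is zero, then the equation of the
    fibre divides that of D.

    Thus A.D / mult_x D >= b - ae for every such D, while the fibre gives the
    ratio a.  A curve of bidegree (1, 0) through x has multiplicity one there and
    gives b - ae: X0 itself if x lies on it, and a horizontal line if e = 0
    ([seshadri_on_section]).  If e > 0 and x is not on X0, then D is not X0, so
    y0 does not divide its equation, and be >= e al.  Then
    A.D >= be a >= al a >= a mult_x D, and the fibre alone computes the constant
    ([seshadri_off_section]). *)

Set Implicit Arguments.
Unset Strict Implicit.
Unset Printing Implicit Defensive.

Import Order.TTheory GRing.Theory Num.Theory.
Local Open Scope quotient_scope.
Local Open Scope ring_scope.

(** * Substitution in multivariate polynomials *)

Lemma rmorph_mmap n (A B K : comNzRingType) (f : {rmorphism A -> B})
    (g : {rmorphism B -> K}) (v : 'I_n -> B) (p : {mpoly A[n]}) :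
  g (mmap f v p) = mmap (g \o f) (g \o v) p.
Proof.
rewrite /mmap rmorph_sum; apply: eq_bigr => m _.
rewrite rmorphM /mmap1 rmorph_prod; congr (_ * _).
by apply: eq_bigr => i _; rewrite rmorphXn.
Qed.

Lemma eq_mmap n (A B : comNzRingType) (f g : A -> B) (v w : 'I_n -> B)
    (p : {mpoly A[n]}) :
  f =1 g -> v =1 w -> mmap f v p = mmap g w p.
Proof.
move=> fg vw; rewrite /mmap; apply: eq_bigr => m _.
by rewrite fg (mmap1_eq _ vw).
Qed.

(** Being congruent modulo [l] is compatible with sums and products, hence with
    substitution into a polynomial. *)
Lemma mmap_congr n (A B : comNzRingType) (f : A -> B) (v w : 'I_n -> B) (l : B)
    (p : {mpoly A[n]}) :
  (forall i, exists q, v i - w i = l * q) ->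
  exists q, mmap f v p - mmap f w p = l * q.
Proof.
move=> vw; rewrite /mmap.
pose cong (x y : B) := exists q, x - y = l * q.
have congD x x' y y' : cong x x' -> cong y y' -> cong (x + y) (x' + y').
  by move=> [q E] [r F]; exists (q + r); rewrite opprD addrACA E F mulrDr.
have congM x x' y y' : cong x x' -> cong y y' -> cong (x * y) (x' * y').
  move=> [q E] [r F]; exists (q * y + x' * r).
  rewrite mulrDr mulrA -E mulrBl mulrCA -F mulrBr addrA; congr (_ - _).
  by rewrite subrK.
have cong_refl x : cong x x by exists 0; rewrite subrr mulr0.
apply: (big_ind2 cong) => [|x x' y y'|m _]; [exact: cong_refl|exact: congD|].
apply: (congM _ _ _ _ (cong_refl _)).
apply: (big_ind2 cong) => [|x x' y y'|i _]; [exact: cong_refl|exact: congM|].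
by elim: (m i) => [|k IH]; rewrite ?expr0 ?exprS; [exact: cong_refl|exact: congM].
Qed.

Lemma unit_mpolyE n (K : fieldType) (p : {mpoly K[n]}) :
  (p \is a GRing.unit) = (msize p == 1%N).
Proof.
apply/idP/idP => [|/msize_poly1P[c c0 ->]]; last first.
  by rewrite rmorph_unit // unitfE.
move=> up; have [p0 q0] : p != 0 /\ p^-1 != 0.
  by rewrite invr_eq0; split; apply: contraTneq up => ->; rewrite unitr0.
have := msizeM p0 q0; rewrite mulrV // msize1.
rewrite -!msize_poly_eq0 in p0 q0.
by case: (msize p) (msize p^-1) p0 q0 => [|[|u]] [|v]; rewrite //= addnS.
Qed.

Lemma prod_ord4 (K : comNzRingType) (F : 'I_4 -> K) :
  \prod_k F k = F t0 * F t1 * F y0 * F y1.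
Proof.
rewrite !big_ord_recl big_ord0 mulr1 !mulrA.
by congr (F _ * F _ * F _ * F _); apply: val_inj.
Qed.

Lemma ord4P (P : 'I_4 -> Prop) : P t0 -> P t1 -> P y0 -> P y1 -> forall k, P k.
Proof.
move=> P0 P1 P2 P3 [[|[|[|[|k]]]] lt_k] //; set K := Ordinal _.
- by rewrite (_ : K = t0) //; apply: val_inj.
- by rewrite (_ : K = t1) //; apply: val_inj.
- by rewrite (_ : K = y0) //; apply: val_inj.
- by rewrite (_ : K = y1) //; apply: val_inj.
Qed.

(** * Bihomogeneous forms and curves *)

Section Forms.
Variables (R : realType) (e : nat).
Local Notation C := R[i].
Implicit Types (F G : {mpoly C[4]}) (x : surface R e) (D : curve R e) (c d : C).

(** [torus_weight] with the parameters in an arbitrary ring, so that the torus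
    also acts on points with coordinates in a function field. *)
Definition weight (K : comNzRingType) (l m : K) (k : 'I_4) : K :=
  if k == y0 then m else if k == y1 then l ^+ e * m else l.

Lemma bihomogeneous_scale (K : comNzRingType) (f : {rmorphism C -> K})
    (v : 'I_4 -> K) (l m : K) (a b : nat) F :
  bihomogeneous e a b F ->
  mmap f (fun k => weight l m k * v k) F = l ^+ b * m ^+ a * mmap f v F.
Proof.
move=> hF; rewrite /mmap mulr_sumr; apply: eq_big_seq => u /hF[<- <-].
rewrite /mmap1 !prod_ord4 /weight /= !exprMn !exprD exprM; ring.
Qed.

Lemma bihomogeneous_unique a b a' b' F :
  F != 0 -> bihomogeneous e a b F -> bihomogeneous e a' b' F ->
  a = a' /\ b = b'.
Proof.
rewrite -msupp_eq0; case E: (msupp F) => [//|m s] _.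
have mF : m \in msupp F by rewrite E mem_head.
by move=> /(_ m mF)[<- <-] /(_ m mF)[<- <-].
Qed.

Lemma bihomogeneousD a b F G :
  bihomogeneous e a b F -> bihomogeneous e a b G -> bihomogeneous e a b (F + G).
Proof. by move=> hF hG m /msuppD_le; rewrite mem_cat => /orP[/hF|/hG]. Qed.

Lemma bihomogeneousZ a b c F :
  bihomogeneous e a b F -> bihomogeneous e a b (c *: F).
Proof. by move=> hF m /msuppZ_le /hF. Qed.

Lemma bihomogeneousX (m : 'X_{1..4}) :
  bihomogeneous e (m y0 + m y1) (m t0 + m t1 + e * m y1) ('X_[m] : {mpoly C[4]}).
Proof. by move=> u; rewrite msuppX inE => /eqP->. Qed.

Lemma bihomogeneous_linear c d (i j : 'I_4) a b :
  bihomogeneous e a b ('X_i : {mpoly C[4]}) ->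
  bihomogeneous e a b ('X_j : {mpoly C[4]}) ->
  bihomogeneous e a b (c *: 'X_i - d *: 'X_j).
Proof.
move=> hi hj; apply: bihomogeneousD; first exact: bihomogeneousZ.
by rewrite -scaleNr; apply: bihomogeneousZ.
Qed.

Lemma bihomogeneous_t k :
  (k == t0) || (k == t1) -> bihomogeneous e 0 1 ('X_k : {mpoly C[4]}).
Proof.
by case/orP => /eqP-> u; rewrite msuppX inE => /eqP->; rewrite !mnm1E /= muln0.
Qed.

Lemma bihomogeneous_y0 : bihomogeneous e 1 0 ('X_y0 : {mpoly C[4]}).
Proof. by move=> u; rewrite msuppX inE => /eqP->; rewrite !mnm1E /= muln0. Qed.

Lemma bihomogeneous_y1 : bihomogeneous e 1 e ('X_y1 : {mpoly C[4]}).
Proof. by move=> u; rewrite msuppX inE => /eqP->; rewrite !mnm1E /= muln1. Qed.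

Lemma irreducible_msize2 F : msize F = 2 -> irreducible_form F.
Proof.
move=> F2; have F0 : F != 0 by rewrite -msize_poly_eq0 F2.
split=> //; first by rewrite unit_mpolyE F2.
move=> G H FGH; have := F0; rewrite FGH mulf_eq0 negb_or => /andP[G0 H0].
have := msizeM G0 H0; rewrite -FGH F2 !unit_mpolyE.
rewrite -!msize_poly_eq0 in G0 H0.
move: (msize G) (msize H) G0 H0 => [//|[|g]] [//|[|h]] _ _; [by left|by left|by right|].
by rewrite !addnS.
Qed.

Lemma msize_linear c d (i j : 'I_4) : i != j -> (c != 0) || (d != 0) ->
  msize (c *: 'X_i - d *: 'X_j : {mpoly C[4]}) = 2.
Proof.
move=> ij cd; set F := _ - _; apply/eqP; rewrite eqn_leq; apply/andP; split.
  rewrite msizeE; apply/bigmax_leqP_seq => m + _ => /msuppB_le.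
  by rewrite mem_cat => /orP[] /msuppZ_le; rewrite msuppX inE => /eqP->; rewrite mdeg1.
have Fi : F@_U_(i) = c.
  by rewrite mcoeffB !mcoeffZ !mcoeffXU eqxx [j == i]eq_sym (negbTE ij) mulr1 mulr0 subr0.
have Fj : F@_U_(j) = - d.
  by rewrite mcoeffB !mcoeffZ !mcoeffXU eqxx (negbTE ij) mulr1 mulr0 sub0r.
have gt1 k : F@_U_(k) != 0 -> (1 < msize F)%N.
  by rewrite -mcoeff_msupp => /msize_mdeg_lt; rewrite mdeg1.
case/orP: cd => [c0|d0]; [apply: (gt1 i)|apply: (gt1 j)].
  by rewrite Fi.
by rewrite Fj oppr_eq0.
Qed.

(** An irreducible form with a linear factor is a scalar multiple of it. *)
Lemma irreducible_dvd F G H :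
  irreducible_form F -> msize G = 2 -> F = G * H ->
  exists2 c, c != 0 & F = c *: G.
Proof.
move=> [_ _ /(_ G H) irrF] G2 /[dup] FGH /irrF[]; rewrite unit_mpolyE ?G2 //.
by case/msize_poly1P=> c c0 E; exists c; rewrite // FGH E mulrC mul_mpolyC.
Qed.

Lemma coordinate_homogeneous k :
  exists a b, bihomogeneous e a b ('X_k : {mpoly C[4]}).
Proof. by eexists; eexists; apply: bihomogeneousX. Qed.

Lemma coordinate_irreducible k : irreducible_form ('X_k : {mpoly C[4]}).
Proof. by apply: irreducible_msize2; rewrite msizeX mdeg1. Qed.

Definition coordinate_curve k : curve R e :=
  Curve (coordinate_homogeneous k) (coordinate_irreducible k).

Lemma linear_curve c d (i j : 'I_4) a b :
  i != j -> (c != 0) || (d != 0) ->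
  bihomogeneous e a b ('X_i : {mpoly C[4]}) ->
  bihomogeneous e a b ('X_j : {mpoly C[4]}) ->
  exists D : curve R e, equation D = c *: 'X_i - d *: 'X_j.
Proof.
move=> ij cd hi hj.
have hom : exists a b, bihomogeneous e a b (c *: 'X_i - d *: 'X_j : {mpoly C[4]}).
  by exists a, b; apply: bihomogeneous_linear.
by exists (Curve hom (irreducible_msize2 (msize_linear ij cd))).
Qed.

End Forms.

(** * Restriction to the fibre through a point *)

Section Restriction.
Variables (R : realType) (e : nat).
Local Notation C := R[i].
Implicit Types (F G : {mpoly C[4]}) (x : surface R e) (D : curve R e) (c d : C).

Lemma coords_t x : (coords x t0 != 0) || (coords x t1 != 0).
Proof. by rewrite /coords; case: (repr _) => p /= /andP[]. Qed.

Lemma coords_y x : (coords x y0 != 0) || (coords x y1 != 0).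
Proof. by rewrite /coords; case: (repr _) => p /= /andP[]. Qed.

Definition fibre_form x : {mpoly C[4]} :=
  coords x t1 *: 'X_t0 - coords x t0 *: 'X_t1.

(** The affine coordinate line on the fibre through [x] in the chart used by
    [local_coord], with the parameter vanishing at [x]. *)
Definition fibre_param x (k : 'I_4) : {poly C} :=
  (coords x k)%:P +
  (if ((k == y0) || (k == y1)) && (k != fibre_chart x) then 'X else 0).

Definition fibre_restriction x F : {poly C} := mmap polyC (fibre_param x) F.

(** In the chart at [x] the fibre is the line on which the first local
    coordinate vanishes. *)
Lemma fibre_restrictionE x D :
  fibre_restriction x D =
  mmap polyC (fun i : 'I_2 => if i == 0 then 0 else 'X) (local_equation D x).
Proof.
rewrite /local_equation /comp_mpoly rmorph_mmap; apply: eq_mmap => [c|k] /=.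
  by rewrite mmapC.
rewrite tnth_mktuple /local_coord mmapD mmapC /fibre_param; congr (_ + _).
have mX i : mmap polyC (fun i : 'I_2 => if i == 0 then 0 else 'X) ('X_i : {mpoly C[2]}) =
    if i == 0 then 0 else 'X by rewrite mmapX mmap1U.
rewrite /base_chart /fibre_chart.
by case: (coords x t0 != 0); case: (coords x y0 != 0); elim/ord4P: k;
  rewrite /= ?mmap0 ?mX.
Qed.

(** Only the coordinate y0 or y1 outside the chart is not constant on the line,
    and its exponent is at most [a] in a form of bidegree (a, b). *)
Lemma size_fibre_restriction a b x F :
  bihomogeneous e a b F -> (size (fibre_restriction x F) <= a.+1)%N.
Proof.
move=> hF; rewrite /fibre_restriction /mmap big_seq.
apply: (leq_trans (size_sum _ _ _)); apply/bigmax_leqP_seq => m _ mF.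
rewrite mul_polyC; apply: leq_trans (size_scale_leq _ _) _.
have size_const k i : fibre_param x k = (coords x k)%:P ->
    (size (fibre_param x k ^+ i) <= 1)%N.
  by move=> ->; rewrite -rmorphXn size_polyC_leq1.
have size_lin k i : (size (fibre_param x k ^+ i) <= i.+1)%N.
  elim: i => [|i IH]; first by rewrite expr0 size_poly1.
  rewrite exprS; apply: leq_trans (size_polyMleq _ _) _.
  have : (size (fibre_param x k) <= 2)%N.
    apply: leq_trans (size_polyD _ _) _; rewrite geq_max.
    rewrite (leq_trans (size_polyC_leq1 _)) //=.
    by case: ifP; rewrite ?size_polyX ?size_poly0.
  by move: IH; lia.
have szM (p q : {poly C}) i j : (size p <= i.+1)%N -> (size q <= j.+1)%N ->
    (size (p * q)%R <= (i + j).+1)%N.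
  by move=> hp hq; apply: leq_trans (size_polyMleq _ _) _; lia.
rewrite /mmap1 prod_ord4; have [<- _] := hF _ mF.
apply: (szM _ _ _ _ _ (size_lin _ _)).
apply: (szM _ _ 0%N (m y0) _ (size_lin _ _)).
apply: (szM _ _ 0%N 0%N); apply: size_const;
  by rewrite /fibre_param /= addr0.
Qed.

(** A form that vanishes on the affine line vanishes at every [K]-point of the
    fibre with nonzero coordinates, for any extension field [K]: the torus moves
    such a point onto the line.  Over the fraction field of the Cox ring, with the
    variables for [T], the point in question is a generic point of the fibre. *)
Lemma fibre_restriction_eq0_mmap (K : fieldType) (iota : {rmorphism C -> K})
    (T : 'I_4 -> K) a b x F :
  (forall k, T k != 0) -> bihomogeneous e a b F -> fibre_restriction x F = 0 ->
  mmap iota (fun k => if (k == t0) || (k == t1)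
                      then iota (coords x k / coords x (base_chart x)) * T (base_chart x)
                      else T k) F = 0.
Proof.
move=> T0 hF rF0; set i := base_chart x; set p := coords x.
have pi0 : p i != 0.
  by rewrite /p /i /base_chart; have := coords_t x; case: ifP => // _ ->.
have iota0 c : c != 0 -> iota c != 0 by rewrite fmorph_eq0.
pose l := T i / iota (p i).
have l0 : l != 0 by rewrite mulf_neq0 ?invr_eq0 ?iota0.
pose v s k := (map_poly iota (fibre_param x k)).[s].
have vF s : mmap iota (v s) F = 0.
  have com_s : commr_rmorph iota s by move=> c; apply: mulrC.
  have := rmorph_mmap polyC (horner_morph com_s) (fibre_param x) F.
  rewrite [mmap _ _ _]rF0 rmorph0 => E0.
  rewrite [RHS]E0; apply: eq_mmap => // c /=.
  by rewrite /horner_morph map_polyC hornerC.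
have vE s k : v s k = iota (p k) +
    (if ((k == y0) || (k == y1)) && (k != fibre_chart x) then s else 0).
  rewrite /v rmorphD /= map_polyC hornerD hornerC; congr (_ + _).
  by case: ifP => _; rewrite ?map_polyX ?rmorph0 ?hornerE.
(* The torus element (l, m) and the parameter s for which (l, m) . v s is the
   given point: l adjusts the base coordinates, m the chart coordinate of the
   fibre, and s the remaining one. *)
have [m [s [my0 my1]]] : exists m s,
    m * v s y0 = T y0 /\ l ^+ e * m * v s y1 = T y1.
  have le0 : l ^+ e != 0 by rewrite expf_neq0.
  have [q0|q0] := boolP (p y0 != 0).
    exists (T y0 / iota (p y0)).
    exists (T y1 / (l ^+ e * (T y0 / iota (p y0))) - iota (p y1)).
    rewrite !vE /fibre_chart q0 /= addr0 [_ + (_ - _)]addrC subrK.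
    by split; field; rewrite ?le0 ?T0 ?iota0.
  have q1 : p y1 != 0 by have := coords_y x; rewrite (negbTE q0).
  exists (T y1 / (l ^+ e * iota (p y1))).
  exists (T y0 / (T y1 / (l ^+ e * iota (p y1))) - iota (p y0)).
  rewrite !vE /fibre_chart (negbTE q0) /= addr0 [_ + (_ - _)]addrC subrK.
  by split; field; rewrite ?le0 ?T0 ?iota0.
rewrite (@eq_mmap _ _ _ _ iota _ (fun k => weight e l m k * v s k)) //.
  by rewrite (bihomogeneous_scale _ _ _ _ hF) vF mulr0.
have vt k : (k == t0) || (k == t1) -> v s k = iota (p k).
  by rewrite vE => /orP[]/eqP-> /=; rewrite addr0.
elim/ord4P => //; rewrite /weight /= vt // rmorphM fmorphV /l; ring.
Qed.

(** Modulo the equation of the fibre, each t_k is congruent to the multiple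
    (p_k / p_i) t_i, where p_i is a nonzero base coordinate of [x].  After this
    substitution [F] becomes zero, because it vanishes at a generic point of the
    fibre. *)
Lemma fibre_restriction_eq0 a b x F :
  bihomogeneous e a b F -> fibre_restriction x F = 0 ->
  exists G, F = fibre_form x * G.
Proof.
move=> hF rF0.
pose i := base_chart x; pose p := coords x.
have pi0 : p i != 0.
  by rewrite /p /i /base_chart; have := coords_t x; case: ifP => // _ ->.
pose w (k : 'I_4) : {mpoly C[4]} :=
  if (k == t0) || (k == t1) then (p k / p i)%:MP * 'X_i else 'X_k.
have Fw0 : mmap (@mpolyC _ _) w F = 0.
  have X0 k : FracField.tofrac ('X_k : {mpoly C[4]}) != 0.
    by rewrite tofrac_eq0 -msize_poly_eq0 msizeX.
  apply/eqP; rewrite -tofrac_eq0 rmorph_mmap.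
  rewrite -[X in _ == X](fibre_restriction_eq0_mmap
    (@FracField.tofrac _ \o @mpolyC 4 C) X0 hF rF0).
  apply/eqP/eq_mmap => // k /=; rewrite /w; case: ifP => // _.
  by rewrite rmorphM.
have [|G] := @mmap_congr _ _ _ (@mpolyC 4 C) (fun k => 'X_k) w (fibre_form x) F.
  rewrite /w /i /fibre_form -/p -!mul_mpolyC.
  have inv k : p k != 0 -> (p k)%:MP_[4] * (p k)^-1%:MP = 1.
    by move=> pk0; rewrite -mpolyCM divff // mpolyC1.
  move: pi0; rewrite /i /base_chart -/p; case: ifP => _ /inv pi1.
    elim/ord4P; rewrite /= ?mpolyCM ?pi1;
      [exists 0|exists (- (p t0)^-1%:MP)|exists 0|exists 0]; try ring.
    by rewrite -[X in X - _]mul1r -pi1; ring.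
  elim/ord4P; rewrite /= ?mpolyCM ?pi1;
    [exists (p t1)^-1%:MP|exists 0|exists 0|exists 0]; try ring.
  by rewrite -[X in X - _]mul1r -pi1; ring.
rewrite Fw0 subr0 => EG; exists G; rewrite -EG.
by rewrite -{1}[F]comp_mpoly_id; apply: eq_mmap => // k; rewrite tnth_mktuple.
Qed.

End Restriction.

(** * Multiplicity at a point *)

Section Multiplicity.
Variables (R : realType) (e : nat).
Local Notation C := R[i].
Implicit Types (x : surface R e) (D : curve R e).

Lemma order_at_origin_le (g : {mpoly C[2]}) m :
  m \in msupp g -> (order_at_origin g <= mdeg m)%N.
Proof.
rewrite /order_at_origin; elim: (msupp g) => //= u s IH.
rewrite inE big_cons geq_min => /orP[/eqP<-|/IH->]; by rewrite ?leqnn ?orbT.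
Qed.

Lemma order_at_origin_gt0 (g : {mpoly C[2]}) :
  g != 0 -> g@_0 = 0 -> (0 < order_at_origin g)%N.
Proof.
move=> g0 gc; rewrite /order_at_origin big_seq.
elim/big_ind: _ => [|u v|m]; first by rewrite lt0n msize_poly_eq0.
  by rewrite leq_min => -> ->.
rewrite lt0n mdeg_eq0 mcoeff_msupp; apply: contraNneq => ->; exact/eqP.
Qed.

Lemma local_equation_const x D : (local_equation D x)@_0 = D.@[coords x].
Proof.
rewrite /local_equation /comp_mpoly rmorph_mmap; apply: eq_mmap => [c|k] /=.
  by rewrite mpolyCK.
rewrite tnth_mktuple mcoeffD mpolyCK.
have X0 (i : 'I_2) : ('X_i : {mpoly C[2]})@_0 = 0.
  by rewrite mcoeffX -mdeg_eq0 mdeg1.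
by case: ifP => _; [|case: ifP => _]; rewrite ?mcoeff0 ?X0 addr0.
Qed.

Lemma mult_gt0 x D : local_equation D x != 0 -> lies_on x D -> (0 < mult x D)%N.
Proof.
by move=> g0 xD; apply: order_at_origin_gt0; rewrite ?local_equation_const.
Qed.

(** The leading term of the restriction comes from a monomial of the local
    equation that is a pure power of the fibre coordinate. *)
Lemma mult_le x D a b :
  bihomogeneous e a b D -> fibre_restriction x D != 0 -> (mult x D <= a)%N.
Proof.
move=> hD h0; have sz := size_fibre_restriction x hD.
have {sz} le_a : ((size (fibre_restriction x D)).-1 <= a)%N by move: sz; lia.
apply: leq_trans le_a; rewrite leqNgt; apply/negP => lt_mult.
move: h0; rewrite -lead_coef_eq0 lead_coefE => /eqP; apply.
set k := _.-1 in lt_mult *.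
rewrite fibre_restrictionE /mmap coef_sum big_seq big1 // => m mg.
have := leq_trans lt_mult (order_at_origin_le mg).
rewrite mdegE /mmap1 !big_ord_recl !big_ord0 /= addn0 mulr1.
set m1 := m (lift _ _); case: (m ord0) => [|j].
  (* A power of the fibre coordinate has degree at least the multiplicity, so it
     contributes nothing to the coefficient of degree k. *)
  rewrite add0n expr0 mul1r coefCM coefXn => lt_k.
  by rewrite ltn_eqF ?mulr0.
by rewrite exprS mul0r mul0r mulr0 coef0.
Qed.

Lemma mult_fibre x D c :
  c != 0 -> equation D = c *: fibre_form x -> mult x D = 1%N.
Proof.
move=> c0 ED.
have [d d0 Eg] : exists2 d, d != 0 & local_equation D x = d *: 'X_(0 : 'I_2).
  rewrite /local_equation ED /fibre_form comp_mpolyZ comp_mpolyB !comp_mpolyZ.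
  rewrite /comp_mpoly !mmapX !mmap1U !tnth_mktuple /local_coord /base_chart.
  have := coords_t x; have [p0 _|/negPn/eqP p0 /= p1] := boolP (coords x t0 != 0).
    exists (- (c * coords x t0)); first by rewrite oppr_eq0 mulf_neq0.
    rewrite /= (_ : t1 == fibre_chart x = false); last first.
      by rewrite /fibre_chart; case: ifP.
    rewrite /= -!mul_mpolyC mpolyCN mpolyCM; ring.
  exists (c * coords x t1); first by rewrite mulf_neq0.
  rewrite /= (_ : t0 == fibre_chart x = false); last first.
    by rewrite /fibre_chart; case: ifP.
  rewrite /= p0 -!mul_mpolyC mpolyCM mpolyC0; ring.
rewrite /mult /order_at_origin Eg msuppMCX // big_cons big_nil mdeg1.
by rewrite msizeZ // msizeX mdeg1.
Qed.

(** The local form of the inequality mult_x D <= D.f for a curve D other than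
    the fibre through [x]. *)
Lemma fibre_or_mult_le x D a b :
  bihomogeneous e a b D -> lies_on x D ->
  (exists2 c, c != 0 & equation D = c *: fibre_form x) \/ (0 < mult x D <= a)%N.
Proof.
move=> hD xD; have [h0|h0] := eqVneq (fibre_restriction x D) 0.
  have [G EG] := fibre_restriction_eq0 hD h0.
  left; apply: irreducible_dvd EG; first exact: curve_irreducible.
  by apply: msize_linear; rewrite // orbC coords_t.
right; rewrite (mult_le hD h0) andbT; apply: mult_gt0 => //.
by apply: contraNneq h0 => g0; rewrite fibre_restrictionE g0 mmap0.
Qed.

End Multiplicity.

(** * The intersection pairing *)

Section Pairing.
Variables (R : realType) (e : nat).
Local Notation C := R[i].
Local Notation coordinate_curve := (coordinate_curve R e).
Implicit Types (x : surface R e) (D E : curve R e).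

Lemma lies_on_coordinate x k : lies_on x (coordinate_curve k) <-> coords x k = 0.
Proof. by rewrite /lies_on /= mevalXU. Qed.

(** The curves t0 = 0 and y0 = 0 meet in one point, since the torus acts
    transitively on the pairs of nonzero coordinates (t1, y1). *)
Lemma coordinate_point : exists x : surface R e, forall z : surface R e,
  z = x <-> coords z t0 = 0 /\ coords z y0 = 0.
Proof.
pose p : {ffun 'I_4 -> C} := [ffun k => ((k == t1) || (k == y1))%:R].
have pP : ((p t0 != 0) || (p t1 != 0)) && ((p y0 != 0) || (p y1 != 0)).
  by rewrite !ffunE /= !oner_eq0 orbT.
pose q : cox_point R := exist _ p pP.
exists (\pi_({eq_quot same_orbit_equiv R e}) q) => z; split=> [->|[z0 zy0]].
  rewrite /coords.
  have : same_orbit e q (repr (\pi_({eq_quot same_orbit_equiv R e}) q)).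
    by apply/eqmodP; rewrite reprK.
  by move=> /asboolP[l [m [_ _ h]]]; rewrite !h /= !ffunE /= !mulr0.
rewrite -[z in LHS]reprK; apply/eqmodP/asboolP.
have := coords_t z; have := coords_y z; rewrite z0 zy0 eqxx /= => zy1 zt1.
set l := coords z t1 in zt1; set n := coords z y1 in zy1.
exists l^-1, (n^-1 * l ^+ e); rewrite invr_eq0 mulf_neq0 ?invr_eq0 ?expf_neq0 //.
split=> //; elim/ord4P; rewrite ffunE /torus_weight /= -/(coords z _).
- by rewrite z0 mulr0.
- by rewrite mulVf.
- by rewrite zy0 mulr0.
- by rewrite -/n exprVn mulrCA mulVf ?expf_neq0 // mulr1 mulVf.
Qed.

Lemma coordinate_transversal x :
  coords x t0 = 0 -> coords x y0 = 0 ->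
  transversal_at (coordinate_curve y0) (coordinate_curve t0) x.
Proof.
move=> x0 xy0; split; try by apply/lies_on_coordinate.
rewrite /local_equation /comp_mpoly /= !mmapX !mmap1U !tnth_mktuple /local_coord.
rewrite /base_chart /fibre_chart x0 xy0 eqxx /= mpolyC0 !add0r !mcoeffXU /=.
by rewrite mulr0 mulr1 sub0r oppr_eq0 oner_eq0.
Qed.

(** The quotient of the equation of [D] by y0^a t0^b is a rational function. *)
Lemma lin_equiv_class D a b :
  bihomogeneous e a b D ->
  lin_equiv (prime_divisor D)
    [:: (a%:Z, coordinate_curve y0); (b%:Z, coordinate_curve t0)].
Proof.
move=> hD; pose Q : {mpoly C[4]} := 'X_[U_(y0) *+ a + U_(t0) *+ b].
have Q0 : Q != 0 by rewrite -msize_poly_eq0 msizeX.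
exists a, b, (equation D), Q; split=> //.
- move=> m; rewrite msuppX inE => /eqP->.
  by rewrite !mnmDE !mulmnE !mnm1E /=; lia.
- by case: (curve_irreducible D).
rewrite /divisor_section !big_cons !big_nil /= !mulr1 expr1z -!exprnP.
rewrite -!tofracXn -tofracM mulrCA.
have -> : 'X_y0 ^+ a * 'X_t0 ^+ b = Q by rewrite !mpolyXn -mpolyXD.
by rewrite mulfV ?mulr1 // tofrac_eq0.
Qed.

Variable I : curve R e -> curve R e -> int.
Hypothesis HI : intersection_pairing I.

Lemma pairing_class D E a b : bihomogeneous e a b D ->
  I D E = a%:Z * I (coordinate_curve y0) E + b%:Z * I (coordinate_curve t0) E.
Proof.
move=> /lin_equiv_class /(pairing_lin_equiv HI (prime_divisor E)).
by rewrite /intersect !big_cons !big_nil /= !addr0 !mulr1 mul1r.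
Qed.

Lemma pairing_disjoint D E :
  (forall x, ~ (lies_on x D /\ lies_on x E)) -> I D E = 0.
Proof.
move=> dis; rewrite (pairing_transversal HI (s := [::])) // => x.
by rewrite in_nil; split=> // /dis.
Qed.

(** The fibre t1 = 0 is equivalent to t0 = 0 and disjoint from it. *)
Lemma pairing_t0t0 : I (coordinate_curve t0) (coordinate_curve t0) = 0.
Proof.
have := @pairing_disjoint (coordinate_curve t1) (coordinate_curve t0).
rewrite (@pairing_class _ _ 0 1) ?mul0r ?mul1r ?add0r; last exact: bihomogeneous_t.
apply=> x [/lies_on_coordinate x1 /lies_on_coordinate x0].
by have := coords_t x; rewrite x0 x1 eqxx.
Qed.

Lemma pairing_y0t0 : I (coordinate_curve y0) (coordinate_curve t0) = 1.
Proof.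
have [x0 x0P] := coordinate_point.
rewrite (pairing_transversal HI (s := [:: x0])) // => x; rewrite inE.
  split=> [/eqP/x0P[z0 z1]|[/lies_on_coordinate z1 /lies_on_coordinate z0]].
    by split; apply/lies_on_coordinate.
  by apply/eqP/x0P.
by move=> /eqP/x0P[z0 z1]; apply: coordinate_transversal.
Qed.

(** The curve y1 = 0 is equivalent to (y0 = 0) + e (t0 = 0) and disjoint from
    y0 = 0. *)
Lemma pairing_y0y0 : I (coordinate_curve y0) (coordinate_curve y0) = - e%:Z.
Proof.
have := @pairing_disjoint (coordinate_curve y1) (coordinate_curve y0).
rewrite (@pairing_class _ _ 1 e); last exact: bihomogeneous_y1.
rewrite [I (coordinate_curve t0) _](pairing_sym HI) pairing_y0t0 mul1r mulr1.
move=> H; apply/eqP; rewrite -addr_eq0; apply/eqP/H => x.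
move=> [/lies_on_coordinate x1 /lies_on_coordinate x0].
by have := coords_y x; rewrite x0 x1 eqxx.
Qed.

Lemma pairingE D E a b a' b' :
  bihomogeneous e a b D -> bihomogeneous e a' b' E ->
  I D E = (a * b')%:Z + (b * a')%:Z - (e * a * a')%:Z.
Proof.
move=> hD hE; rewrite (pairing_class E hD).
rewrite [I (coordinate_curve y0) E](pairing_sym HI).
rewrite [I (coordinate_curve t0) E](pairing_sym HI) !(pairing_class _ hE).
rewrite pairing_t0t0 [I (coordinate_curve t0) _](pairing_sym HI).
rewrite pairing_y0t0 pairing_y0y0 !PoszM; ring.
Qed.

(** The equation of a section is linear in (y0, y1).  Scaling y0 and y1 by 2
    multiplies it by 2, and also by 2^a if it has bidegree (a, b); hence a = 1. *)
Lemma section_class D : is_section D -> exists b, bihomogeneous e 1 b D.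
Proof.
move=> [g [h [_ ED]]]; have [a [b hD]] := curve_bihomogeneous D.
exists b; rewrite (_ : 1%N = a) //.
have D0 : equation D != 0 by case: (curve_irreducible D).
have X4 (F : {mpoly C[4]}) : mmap (@mpolyC _ _) (fun k => 'X_k) F = F.
  rewrite -[RHS]comp_mpoly_id; apply: eq_mmap => // k.
  by rewrite tnth_mktuple.
have := bihomogeneous_scale (@mpolyC 4 C) (fun k => 'X_k) 1 2%:R hD.
rewrite expr1n mul1r X4 {1}ED.
pose w k : {mpoly C[4]} := weight e 1 2%:R k * 'X_k.
have base (G : {mpoly C[2]}) : mmap (@mpolyC _ _) w
    (comp_mpoly [tuple 'X_t0; 'X_t1] G) = comp_mpoly [tuple 'X_t0; 'X_t1] G.
  rewrite {1}/comp_mpoly rmorph_mmap; apply: eq_mmap => [c|] /=.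
    by rewrite mmapC.
  by case=> [[|[|//]] lt_k]; rewrite /= mmapX mmap1U /w /weight mul1r.
rewrite mmapB !rmorphM /= !base !mmapX !mmap1U /w /weight /= expr1n mul1r.
have -> (u v r s k : {mpoly C[4]}) : u * (k * r) - v * (k * s) = k * (u * r - v * s).
  by ring.
rewrite -ED => /(mulIf D0) /eqP; rewrite -natrX -!mpolyC_nat mpolyC_eq eqr_nat.
by case: a {hD} => [|[|a]] //; rewrite !expnS; lia.
Qed.

(** A section of bidegree (1, b) has self-intersection 2b - e, and the section
    y0 = 0 attains -e. *)
Lemma minimal_section_class (X0 : curve R e) :
  minimal_section I X0 -> bihomogeneous e 1 0 X0.
Proof.
move=> [sX0 minX0]; have [b hX0] := section_class sX0.
suff b0 : b = 0%N by rewrite b0 in hX0.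
have /minX0 : is_section (coordinate_curve y0).
  exists 0, 1; split=> [c _|]; first by rewrite meval1 oner_neq0 orbT.
  by rewrite comp_mpoly1 mul1r comp_mpoly0 mul0r subr0.
rewrite (pairingE hX0 hX0) pairing_y0y0; lia.
Qed.

Lemma fibre_class (f : curve R e) : is_fibre f -> bihomogeneous e 0 1 f.
Proof.
by move=> [c0 [c1 [_ ->]]]; apply: bihomogeneous_linear; apply: bihomogeneous_t.
Qed.

End Pairing.

(** * Seshadri constants *)

Section Seshadri.
Variables (R : realType) (e : nat).
Local Notation C := R[i].
Variables (I : curve R e -> curve R e -> int) (A : divisor R e).
Implicit Types (x : surface R e) (D : curve R e).

(** The positivity of the multiplicity has to be established along with the
    bound: a ratio with zero denominator would have the value 0. *)
Lemma seshadri_eq x (v : int) D0 :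
  lies_on x D0 -> mult x D0 = 1%N -> intersect I A (prime_divisor D0) = v ->
  (forall D, lies_on x D ->
     (0 < mult x D)%N /\ v * (mult x D)%:Z <= intersect I A (prime_divisor D)) ->
  seshadri I A x = v%:~R.
Proof.
move=> xD0 m1 AD0 low; rewrite /seshadri; set S := (X in inf X).
have Sv : S v%:~R by exists D0 => //; rewrite AD0 m1 divr1.
have lbS : lbound S v%:~R.
  move=> _ [D xD <-]; have [m0 le_v] := low D xD.
  rewrite ler_pdivlMr ?ltr0n //.
  by rewrite -[(mult x D)%:R]/((mult x D)%:Z%:~R) -intrM ler_int.
apply/eqP; rewrite eq_le; apply/andP; split.
  by apply: ge_inf => //; exists v%:~R.
by apply: lb_le_inf => //; exists v%:~R.
Qed.

Lemma fibre_through x :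
  exists D : curve R e, [/\ lies_on x D, bihomogeneous e 0 1 D & mult x D = 1%N].
Proof.
have ht0 := @bihomogeneous_t R e t0 isT; have ht1 := @bihomogeneous_t R e t1 isT.
have cx : (coords x t1 != 0) || (coords x t0 != 0) by rewrite orbC coords_t.
have [D ED] := linear_curve (isT : t0 != t1) cx ht0 ht1.
exists D; split.
- by rewrite /lies_on ED mevalB !mevalZ !mevalXU mulrC subrr.
- by rewrite ED; apply: bihomogeneous_linear.
- by apply: (@mult_fibre _ _ _ _ 1); rewrite ?oner_neq0 // scale1r.
Qed.

(** If y0 does not divide the equation, then it has a monomial without y0, which
    therefore contains y1^a and has degree at least e a in the second grading.
    If y0 does divide it, then [D] is the curve y0 = 0. *)
Lemma y0_not_component x D a b :
  bihomogeneous e a b D -> lies_on x D -> coords x y0 != 0 -> (e * a <= b)%N.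
Proof.
move=> hD xD xy0.
have [|/allPn[m mD]] :=
  boolP (all (fun m : 'X_{1..4} => m y0 != 0)%N (msupp D)); last first.
  by rewrite negbK => /eqP m0; have [<- <-] := hD m mD; rewrite m0; lia.
move=> /allP div; exfalso.
have ED : equation D = 'X_y0 *
    \sum_(m <- msupp D) D@_m *: 'X_[(m - U_(y0))%MM].
  rewrite {1}[equation D]mpolyE mulr_sumr big_seq [RHS]big_seq.
  apply: eq_bigr => m /div m0; rewrite -scalerAr -mpolyXD addmC submK //.
  by apply/mnm_lepP => i; rewrite mnm1E; case: eqP => // <-; rewrite lt0n.
have X2 : msize ('X_y0 : {mpoly C[4]}) = 2 by rewrite msizeX mdeg1.
have [c c0 E] := irreducible_dvd (curve_irreducible D) X2 ED.
move: xD; rewrite /lies_on E mevalZ mevalXU => /eqP.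
by rewrite mulf_eq0 (negbTE c0) (negbTE xy0).
Qed.

(** For positive [e], the forms of bidegree (1, 0) are the multiples of y0. *)
Lemma y0_in_minimal_section x D :
  (0 < e)%N -> bihomogeneous e 1 0 D -> coords x y0 = 0 -> lies_on x D.
Proof.
move=> e0 hD xy0; rewrite /lies_on mevalE big_seq big1 // => m /hD[m1 m0].
rewrite prod_ord4 xy0.
have -> : m y0 = 1%N by move: m1 m0; case: (m y1) => [|k]; nia.
by rewrite expr1 mulr0 mul0r mulr0.
Qed.

Variables a b : int.
Hypothesis degA : forall D al be, bihomogeneous e al be D ->
  intersect I A (prime_divisor D) = al%:Z * (b - a * e%:Z) + be%:Z * a.
Hypothesis nefA : nef I A.

Lemma nef_coef : 0 <= a /\ 0 <= b - a * e%:Z.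
Proof.
have := nefA (coordinate_curve R e t0); have := nefA (coordinate_curve R e y0).
rewrite (degA (D := coordinate_curve R e t0) (@bihomogeneous_t R e t0 isT)).
by rewrite (degA (D := coordinate_curve R e y0) (@bihomogeneous_y0 R e))
  !mul0r !mul1r addr0 add0r.
Qed.

(** The lower bound for a curve through [x] reduces to the curves other than the
    fibre, where only mult_x D <= al is known. *)
Lemma fibre_or_mult_bound x D al be (v : int) :
  bihomogeneous e al be D -> lies_on x D -> v <= a ->
  (forall m : nat, (m <= al)%N ->
     v * m%:Z <= al%:Z * (b - a * e%:Z) + be%:Z * a) ->
  (0 < mult x D)%N /\ v * (mult x D)%:Z <= intersect I A (prime_divisor D).
Proof.
move=> hD xD va low; rewrite (degA hD).
have [[c c0 ED]|/andP[m0 m_le]] := fibre_or_mult_le hD xD; last by split; last exact: low.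
have D0 : equation D != 0 by case: (curve_irreducible D).
have hF : bihomogeneous e 0 1 D.
  by rewrite ED; apply/bihomogeneousZ/bihomogeneous_linear; apply: bihomogeneous_t.
have [-> ->] := bihomogeneous_unique D0 hD hF.
by rewrite (mult_fibre c0 ED) !mulr1 mul0r mul1r add0r.
Qed.

(** The fibre and [H] are smooth at [x] and have degrees [a] and [b - a * e];
    every other curve through [x] has ratio at least [b - a * e]. *)
Lemma seshadri_on_section x (H : curve R e) :
  bihomogeneous e 1 0 H -> lies_on x H ->
  seshadri I A x = (Num.min a (b - a * e%:Z))%:~R.
Proof.
move=> hH xH; have [a0 b0] := nef_coef.
have mH : mult x H = 1%N.
  have [[c c0 EH]|] := fibre_or_mult_le hH xH; last by lia.
  exact: mult_fibre EH.
have [D0 [xD0 [mD0 AD0]]] : exists D0, [/\ lies_on x D0, mult x D0 = 1%N &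
    intersect I A (prime_divisor D0) = Num.min a (b - a * e%:Z)].
  have [F [xF hF mF]] := fibre_through x.
  case: leP => _; [exists F|exists H]; split=> //.
    by rewrite (degA hF) mul0r mul1r add0r.
  by rewrite (degA hH) mul0r mul1r addr0.
apply: (seshadri_eq xD0 mD0 AD0) => D xD.
have [al [be hD]] := curve_bihomogeneous D.
apply: (fibre_or_mult_bound hD xD) => [|m m_le]; first by lia.
apply: (@le_trans _ _ (al%:Z * (b - a * e%:Z))); last by rewrite lerDl mulr_ge0.
rewrite mulrC; apply: ler_pM => //; lia.
Qed.

(** The term al (b - ae) of the degree is dropped: be a alone bounds a mult_x D,
    by be >= e al >= al >= mult_x D. *)
Lemma seshadri_off_section x :
  (0 < e)%N -> coords x y0 != 0 -> seshadri I A x = a%:~R.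
Proof.
move=> e0 xy0; have [a0 b0] := nef_coef; have [F [xF hF mF]] := fibre_through x.
apply: (seshadri_eq xF mF) => [|D xD]; first by rewrite (degA hF) mul0r mul1r add0r.
have [al [be hD]] := curve_bihomogeneous D.
apply: (fibre_or_mult_bound hD xD) => // m m_le.
have be_ge := y0_not_component hD xD xy0.
apply: (@le_trans _ _ (be%:Z * a)); last by rewrite lerDr mulr_ge0.
by rewrite mulrC ler_wpM2r // lez_nat (leq_trans m_le) //
  (leq_trans _ be_ge) // leq_pmull.
Qed.

End Seshadri.

Theorem theorem5p1 (R : realType) (e : nat)
    (I : curve R e -> curve R e -> int) (X0 f : curve R e)
    (A : divisor R e) (a b : int) :
  intersection_pairing I ->
  minimal_section I X0 ->
  is_fibre f ->
  nef I A ->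
  num_equiv I A [:: (a, X0); (b, f)] ->
  (e = 0%N ->
    forall x : surface R e,
      seshadri I A x =
        (Num.min (intersect I A (prime_divisor f)) (intersect I A (prime_divisor X0)))%:~R /\
      Num.min (intersect I A (prime_divisor f)) (intersect I A (prime_divisor X0)) = Num.min a b) /\
  ((0 < e)%N ->
    (forall x : surface R e, lies_on x X0 ->
      seshadri I A x =
        (Num.min (intersect I A (prime_divisor f)) (intersect I A (prime_divisor X0)))%:~R /\
      Num.min (intersect I A (prime_divisor f)) (intersect I A (prime_divisor X0)) =
        Num.min a (b - a * e%:Z)) /\
    (forall x : surface R e, ~ lies_on x X0 ->
      seshadri I A x = (intersect I A (prime_divisor f))%:~R /\
      intersect I A (prime_divisor f) = a)).
Proof.
move=> HI minX0 fibf nefA AX.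
have hX := minimal_section_class HI minX0; have hf := fibre_class fibf.
have degA (D : curve R e) al be : bihomogeneous e al be D ->
    intersect I A (prime_divisor D) = al%:Z * (b - a * e%:Z) + be%:Z * a.
  move=> hD; rewrite AX /intersect !big_cons !big_nil /= !addr0 !mulr1.
  rewrite (pairingE HI hX hD) (pairingE HI hf hD).
  rewrite !muln0 !mul0n !mul1n muln1 !PoszM; ring.
have Af : intersect I A (prime_divisor f) = a.
  by rewrite (degA _ _ _ hf) mul0r mul1r add0r.
have AX0 : intersect I A (prime_divisor X0) = b - a * e%:Z.
  by rewrite (degA _ _ _ hX) mul0r mul1r addr0.
rewrite Af AX0; split=> [e0 x|e_gt0]; split.
- have hy0 := @bihomogeneous_y0 R e.
  have := @bihomogeneous_y1 R e; rewrite [X in bihomogeneous _ _ X]e0 => hy1.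
  have cx : (coords x y1 != 0) || (coords x y0 != 0) by rewrite orbC coords_y.
  have [H EH] := linear_curve (isT : y0 != y1) cx hy0 hy1.
  apply: (seshadri_on_section degA nefA (H := H)).
    by rewrite EH; apply: bihomogeneous_linear.
  by rewrite /lies_on EH mevalB !mevalZ !mevalXU mulrC subrr.
- by rewrite e0 mulr0 subr0.
- by move=> x xX; split=> //; apply: (seshadri_on_section degA nefA hX).
- move=> x xX; split=> //; apply: (seshadri_off_section degA nefA) => //.
  by apply/eqP => xy0; apply: xX; apply: y0_in_minimal_section.
Qed.
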